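(* Let $f\in C_c^2(S^2;D_1)$. Then $f$ can be explicitly determined from $\mathcal{L}f$, $\mathcal{T}f$ and $\mathcal{M}f$. In particular, if $f,\tilde f\in C_c^2(S^2;D_1)$ satisfy $\mathcal{L}f=\mathcal{L}\tilde f$, $\mathcal{T}f=\mathcal{T}\tilde f$ and $\mathcal{M}f=\mathcal{M}\tilde f$ on $\mathbb{R}^2$, then $f=\tilde f$.
   Context: $D_1\subset\mathbb{R}^2$ is an open disc of radius $r_1>0$ centered at the origin. $C_c^2(S^2;D_1)$ is the space of symmetric $2$-tensor fields $f=(f_{ij})_{i,j=1,2}$, $f_{12}=f_{21}$, whose components are twice continuously differentiable and compactly supported in $D_1$ (extended by zero to $\mathbb{R}^2$). For symmetric $2$-tensors, $\langle f,g\rangle=f_{11}g_{11}+2f_{12}g_{12}+f_{22}g_{22}$. For vectors $a,b\in\mathbb{R}^2$, $(a\odot b)_{ij}=\frac12(a_ib_j+a_jb_i)$, $a^2=a\odot a$, and $a^\perp=(-a_2,a_1)$. For a unit vector $a$ and a compactly supported function $h$, $\mathcal{X}_a h(x)=\int_0^\infty h(x+ta)\,dt$. Fix unit vectors $u=(u_1,u_2)$ and $v=(-u_1,u_2)$ that are linearly independent (so $u_1u_2\neq0$, i.e. $-1<u_1^2-u_2^2<1$). The longitudinal, transverse and mixed V-line transforms are the functions on $\mathbb{R}^2$ $$\mathcal{L}f=\mathcal{X}_u\langle f,u^2\rangle+\mathcal{X}_v\langle f,v^2\rangle,\quad \mathcal{T}f=\mathcal{X}_u\langle f,(u^\perp)^2\rangle+\mathcal{X}_v\langle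 f,(v^\perp)^2\rangle,\quad \mathcal{M}f=\mathcal{X}_u\langle f,u\odot u^\perp\rangle+\mathcal{X}_v\langle f,v\odot v^\perp\rangle.$$ (Their values on a sufficiently large closed disc centered at the origin determine them on all of $\mathbb{R}^2$.) *)

(* Defs.v *)
From Stdlib Require Import Reals.
From Coquelicot Require Import Coquelicot.

Open Scope R_scope.

Definition vec : Type := (R * R)%type.

Definition perp (a : vec) : vec := (- snd a, fst a).

Definition unit_vec (a : vec) : Prop := (fst a) ^ 2 + (snd a) ^ 2 = 1.

Definition lin_indep (a b : vec) : Prop :=
  forall s t : R,
    s * fst a + t * fst b = 0 -> s * snd a + t * snd b = 0 -> s = 0 /\ t = 0.

(* The point x + t a. *)
Definition along (x a : vec) (t : R) : vec :=
  (fst x + t * fst a, snd x + t * snd a).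

(* Symmetric 2-tensors on the plane; the (2,1) component is [c12]. *)
Record sym2 : Type := Sym2 { c11 : R; c12 : R; c22 : R }.

Definition inner (f g : sym2) : R :=
  c11 f * c11 g + 2 * (c12 f * c12 g) + c22 f * c22 g.

Definition odot (a b : vec) : sym2 :=
  Sym2 (fst a * fst b)
       ((fst a * snd b + snd a * fst b) / 2)
       (snd a * snd b).

Definition disc (r : R) (p : vec) : Prop := (fst p) ^ 2 + (snd p) ^ 2 < r ^ 2.

(* Closure of the set where [h] does not vanish. *)
Definition supp (h : vec -> R) (p : vec) : Prop :=
  forall eps : posreal, exists q : vec, ball p eps q /\ h q <> 0.

(* [supp h] is closed and the disc is bounded, so the inclusion of [supp h] in
   the open disc already makes the support compact. *)
Definition Cc2 (r : R) (h : vec -> R) : Prop :=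
  (forall x y : R, ex_diff_n (fun s t : R => h (s, t)) 2 x y) /\
  (forall p : vec, supp h p -> disc r p).

Definition Cc2_sym2 (r : R) (f : vec -> sym2) : Prop :=
  Cc2 r (fun x => c11 (f x)) /\
  Cc2 r (fun x => c12 (f x)) /\
  Cc2 r (fun x => c22 (f x)).

Definition Xray (a : vec) (h : vec -> R) (x : vec) : R :=
  RInt_gen (fun t : R => h (along x a t)) (at_point 0) (Rbar_locally p_infty).

Definition Lvline (u v : vec) (f : vec -> sym2) (x : vec) : R :=
  Xray u (fun y => inner (f y) (odot u u)) x +
  Xray v (fun y => inner (f y) (odot v v)) x.

Definition Tvline (u v : vec) (f : vec -> sym2) (x : vec) : R :=
  Xray u (fun y => inner (f y) (odot (perp u) (perp u))) x +
  Xray v (fun y => inner (f y) (odot (perp v) (perp v))) x.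

Definition Mvline (u v : vec) (f : vec -> sym2) (x : vec) : R :=
  Xray u (fun y => inner (f y) (odot u (perp u))) x +
  Xray v (fun y => inner (f y) (odot v (perp v))) x.

Definition Ddir (a : vec) (h : vec -> R) (x : vec) : R :=
  Derive (fun t : R => h (along x a t)) 0.

(* Reconstruction of f from the data L, T, M for u = (u1,u2), v = (-u1,u2).
   Write DD = D_u D_v, s = u1^2 - u2^2, d = f11 - f22 and k = 2 f12.  Since
   DD (X_u g + X_v h) = - (D_v g + D_u h), D_u + D_v = 2 u2 d/dx2 and
   D_u - D_v = 2 u1 d/dx1, the data satisfy
     DD (L + T) = - 2 u2 d/dx2 (f11 + f22),
     DD (L - T) = - 2 u2 (s d/dx2 d - 2 u1^2 d/dx1 k),
     2 DD M     = - 2 u2 (2 u1^2 d/dx1 d + s d/dx2 k).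
   The first equation is integrated along (0,1).  The other two say that
     (2 u1^2 d/dx1 - i s d/dx2) (d + i k) = - (2 DD M - i DD (L - T)) / (2 u2).
   For s <> 0 this is a d-bar equation up to scaling, and it is inverted by the
   Cauchy-Pompeiu formula in polar coordinates, in which the Jacobian cancels
   the modulus of the Cauchy kernel; for s = 0 (so 2 u1^2 = 1) it is integrated
   along (1,0). *)

Definition rec_trace (u1 u2 : R) (L T : vec -> R) (x : vec) : R :=
  let DD h := Ddir (u1, u2) (Ddir (- u1, u2) h) in
  / (2 * u2) * Xray (0, 1) (DD (fun y => L y + T y)) x.

Definition rec_diff (u1 u2 : R) (L T M : vec -> R) (x : vec) : R :=
  let DD h := Ddir (u1, u2) (Ddir (- u1, u2) h) in
  let P := DD (fun y => L y - T y) in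
  let Q := DD M in
  let s := u1 ^ 2 - u2 ^ 2 in
  if Req_EM_T s 0 then / u2 * Xray (1, 0) Q x
  else
    / (4 * PI * u2) *
    RInt (fun th : R =>
            let a := (2 * u1 ^ 2 * cos th, - s * sin th) in
            2 * cos th * Xray a Q x - sin th * Xray a P x) 0 (2 * PI).

Definition rec_12 (u1 u2 : R) (L T M : vec -> R) (x : vec) : R :=
  let DD h := Ddir (u1, u2) (Ddir (- u1, u2) h) in
  let P := DD (fun y => L y - T y) in
  let Q := DD M in
  let s := u1 ^ 2 - u2 ^ 2 in
  if Req_EM_T s 0 then - / (4 * u2) * Xray (1, 0) P x
  else
    - / (8 * PI * u2) *
    RInt (fun th : R =>
            let a := (2 * u1 ^ 2 * cos th, - s * sin th) in
            cos th * Xray a P x + 2 * sin th * Xray a Q x) 0 (2 * PI).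

Definition reconstruct (u1 u2 : R) (L T M : vec -> R) (x : vec) : sym2 :=
  Sym2 ((rec_trace u1 u2 L T x + rec_diff u1 u2 L T M x) / 2)
       (rec_12 u1 u2 L T M x)
       ((rec_trace u1 u2 L T x - rec_diff u1 u2 L T M x) / 2).

(* Main.v *)
From Pilot Require Import Defs.
From Stdlib Require Import Reals.
From Coquelicot Require Import Coquelicot.
From Stdlib Require Import Lra Classical FunctionalExtensionality.
(* [Reals] has its own [disc]. *)
Import Pilot.Defs.

Open Scope R_scope.

(** Write [D_a] for the derivative in the direction [a] and [X_a] for the ray
    transform. For a compactly supported C^1 function [h] the fundamental
    theorem of calculus along a ray gives [X_a (D_a h) = - h], and equally
    [D_a (X_a h) = - h], while [D_b] commutes with [X_a]. Hence the operator
    [D_u D_v] turns [X_u g + X_v h] into the local expression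
    [- (D_v g + D_u h)] ([Ddir_Ddir_vline]). Applied to [L + T], [L - T] and
    [M] this yields first-order constant-coefficient differential equations
    for the trace [f11 + f22] and for [d = f11 - f22], [k = 2 f12]
    ([vline_data]).

    The equation for the trace only contains its derivative in the direction
    [(0, 1)], and one more ray transform in that direction integrates it. With
    [s = u1^2 - u2^2], the equations for [d] and [k] give
    [2 u1^2 d/dx1 d + s d/dx2 k] and [s d/dx2 d - 2 u1^2 d/dx1 k]. If [s = 0]
    both are derivatives in the direction [(1, 0)] and are again integrated
    along rays. Otherwise let [a(th) = (A cos th, B sin th)] with
    [A = 2 u1^2] and [B = - s]. A combination of the two equations with
    coefficients depending on [th] equals, up to a constant factor,
    [D_{a(th)} d - D_{a'(th)} k], and another one has [d] and [k] exchanged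
    and a plus sign. Integrating over the ray from [x] in the direction
    [a(th)] and then over [th]:

    - the radial term contributes [- d x] for every [th], so [- 2 PI d x] in
      all ([Xray_ddir_self]);
    - the tangential term contributes nothing ([is_RInt_Xray_tangent]): by
      Fubini ([RInt_fubini]) the integral over [th] may be done first, and at
      a fixed distance [t > 0] its integrand is [1/t] times the
      [th]-derivative of the periodic function [k (x + t a(th))].

    This recovers [d] and [k] at [x] ([RInt_ellipse_reconstruct]). Injectivity
    follows, because the reconstruction only sees the data. *)

(** * Integrals depending on a parameter *)

Lemma continuity_2d_pt_comp_2d (F X Y : R -> R -> R) (s t : R) :
  continuity_2d_pt F (X s t) (Y s t) ->
  continuity_2d_pt X s t -> continuity_2d_pt Y s t ->
  continuity_2d_pt (fun a b => F (X a b) (Y a b)) s t.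
Proof.
  intros HF HX HY.
  apply continuity_2d_pt_filterlim in HF.
  apply continuity_2d_pt_filterlim in HX.
  apply continuity_2d_pt_filterlim in HY.
  apply continuity_2d_pt_filterlim.
  apply (continuous_comp_2 (U := prod_UniformSpace R_UniformSpace R_UniformSpace)
    (fun z => X (fst z) (snd z)) (fun z => Y (fst z) (snd z)) F (s, t)); assumption.
Qed.

Lemma continuity_2d_pt_cos (s t : R) : continuity_2d_pt (fun a _ => cos a) s t.
Proof.
  apply (continuity_1d_2d_pt_comp cos (fun a _ => a));
    [apply continuity_cos | apply continuity_2d_pt_id1].
Qed.

Lemma continuity_2d_pt_sin (s t : R) : continuity_2d_pt (fun a _ => sin a) s t.
Proof.
  apply (continuity_1d_2d_pt_comp sin (fun a _ => a));
    [apply continuity_sin | apply continuity_2d_pt_id1].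
Qed.

Ltac continuity_2d :=
  repeat first
    [ apply continuity_2d_pt_plus | apply continuity_2d_pt_opp | apply continuity_2d_pt_mult
    | apply continuity_2d_pt_id1 | apply continuity_2d_pt_id2 | apply continuity_2d_pt_const
    | apply continuity_2d_pt_cos | apply continuity_2d_pt_sin ].

Lemma continuity_2d_pt_slice (F : R -> R -> R) (s t : R) :
  continuity_2d_pt F s t -> continuous (F s) t.
Proof.
  intros HF.
  apply continuity_2d_pt_filterlim in HF.
  apply (continuous_comp_2 (fun _ : R => s) (fun z : R => z) F t).
  - apply continuous_const.
  - apply continuous_id.
  - exact HF.
Qed.

Lemma continuity_2d_pt_swap (F : R -> R -> R) (s t : R) :
  continuity_2d_pt F s t -> continuity_2d_pt (fun a b => F b a) t s.
Proof.
  intros HF eps. destruct (HF eps) as [d Hd].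
  exists d. intros u v Hu Hv. apply Hd; assumption.
Qed.

(** Uniform continuity near the compact segment makes the integrand vary
    uniformly little with the parameter. *)
Lemma continuous_RInt_param (F : R -> R -> R) (a b c : R) :
  (forall s t, continuity_2d_pt F s t) ->
  continuous (fun s => RInt (F s) a b) c.
Proof.
  intros HF.
  assert (Hex : forall s p q, ex_RInt (F s) p q).
  { intros s p q. apply (ex_RInt_continuous (V := R_CompleteNormedModule)).
    intros z _. apply continuity_2d_pt_slice, HF. }
  assert (Hle : forall p q, p <= q -> continuous (fun s => RInt (F s) p q) c).
  { intros p q Hpq. apply filterlim_locally. intros eps.
    (* The [+ 1] keeps the denominator positive when [p = q]. *)
    assert (He : 0 < eps / (q - p + 1)).
    { apply Rdiv_lt_0_compat; [apply cond_pos | lra]. }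
    destruct (uniform_continuity_2d_1d (fun t s => F s t) p q c
      (fun t _ => continuity_2d_pt_swap F c t (HF c t)) (mkposreal _ He)) as [d Hd].
    exists d. intros s Hs.
    change (Rabs (s - c) < d) in Hs.
    change (Rabs (RInt (F s) p q - RInt (F c) p q) < eps).
    assert (Hm : RInt (F s) p q - RInt (F c) p q = RInt (fun t => F s t - F c t) p q).
    { symmetry. apply (RInt_minus (V := R_CompleteNormedModule)); apply Hex. }
    rewrite Hm.
    apply Rle_lt_trans with ((q - p) * (eps / (q - p + 1))).
    - apply abs_RInt_le_const; [exact Hpq | |].
      + apply (ex_RInt_minus (V := R_NormedModule)); apply Hex.
      + intros t Ht. left.
        apply (Hd t c t s); try assumption; try (destruct d as [d Hd0]; simpl in *; lra).
        * apply Rabs_lt_between in Hs. lra.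
        * rewrite Rminus_diag, Rabs_R0. apply cond_pos.
    - replace (pos eps) with ((q - p + 1) * (eps / (q - p + 1))) at 2 by (field; lra).
      apply Rmult_lt_compat_r; [exact He | lra]. }
  destruct (Rle_dec a b) as [H | H].
  - apply Hle, H.
  - apply (continuous_ext (fun s => opp (RInt (F s) b a))).
    + intros s. apply opp_RInt_swap, Hex.
    + apply (continuous_opp (V := R_NormedModule)), Hle. lra.
Qed.

(** As functions of the endpoint [b], both iterated integrals vanish at [a] and
    have derivative [RInt (F b) c d]. *)
Lemma RInt_fubini (F : R -> R -> R) (a b c d : R) :
  (forall s t, continuity_2d_pt F s t) ->
  RInt (fun s => RInt (F s) c d) a b = RInt (fun t => RInt (fun s => F s t) a b) c d.
Proof.
  intros HF.
  assert (Hex : forall s p q, ex_RInt (F s) p q).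
  { intros s p q. apply (ex_RInt_continuous (V := R_CompleteNormedModule)).
    intros z _. apply continuity_2d_pt_slice, HF. }
  assert (HF' : forall t s, continuity_2d_pt (fun t s => F s t) t s).
  { intros t s. apply continuity_2d_pt_swap, HF. }
  assert (Hin : forall t q, is_derive (fun q => RInt (fun s => F s t) a q) q (F q t)).
  { intros t q.
    apply (is_derive_RInt (fun s => F s t) (fun q => RInt (fun s => F s t) a q) a).
    - apply filter_forall. intros z. apply (RInt_correct (V := R_CompleteNormedModule)).
      apply (ex_RInt_continuous (V := R_CompleteNormedModule)).
      intros y _. apply (continuity_2d_pt_slice (fun t s => F s t)), HF'.
    - apply (continuity_2d_pt_slice (fun t s => F s t)), HF'. }
  assert (H1 : forall q, is_derive (fun q => RInt (fun s => RInt (F s) c d) a q) q (RInt (F q) c d)).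
  { intros q.
    apply (is_derive_RInt (fun s => RInt (F s) c d)
             (fun q => RInt (fun s => RInt (F s) c d) a q) a).
    - apply filter_forall. intros z. apply (RInt_correct (V := R_CompleteNormedModule)).
      apply (ex_RInt_continuous (V := R_CompleteNormedModule)).
      intros y _. apply continuous_RInt_param, HF.
    - apply continuous_RInt_param, HF. }
  assert (H2 : forall q, is_derive (fun q => RInt (fun t => RInt (fun s => F s t) a q) c d) q
                           (RInt (F q) c d)).
  { intros q.
    assert (HD : forall q t, Derive (fun z => RInt (fun s => F s t) a z) q = F q t).
    { intros p t. apply is_derive_unique, Hin. }
    replace (RInt (F q) c d)
      with (RInt (fun t => Derive (fun z => RInt (fun s => F s t) a z) q) c d).
    - apply (is_derive_RInt_param (fun q t => RInt (fun s => F s t) a q)).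
      + apply filter_forall. intros p t _. eexists. apply Hin.
      + intros t _. apply (continuity_2d_pt_ext F).
        * intros p r. symmetry. apply HD.
        * apply HF.
      + apply filter_forall. intros p.
        apply (ex_RInt_continuous (V := R_CompleteNormedModule)).
        intros z _. apply (continuous_RInt_param (fun t s => F s t)), HF'.
    - apply RInt_ext. intros t _. apply HD. }
  set (phi := fun q => RInt (fun s => RInt (F s) c d) a q
                       - RInt (fun t => RInt (fun s => F s t) a q) c d).
  assert (Hphi : forall q, is_derive phi q 0).
  { intros q. replace 0 with (RInt (F q) c d - RInt (F q) c d) by ring.
    apply (is_derive_minus (V := R_NormedModule)); [apply H1 | apply H2]. }
  assert (H0 : phi a = 0).
  { unfold phi. rewrite RInt_point.
    rewrite (RInt_ext _ (fun _ => 0)).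
    - rewrite RInt_const. unfold scal, zero; simpl; unfold mult; simpl. ring.
    - intros t _. apply (RInt_point (V := R_CompleteNormedModule)). }
  apply Rminus_diag_uniq. change (phi b = 0). rewrite <- H0.
  destruct (Rtotal_order a b) as [H | [H | H]].
  - symmetry. apply (eq_is_derive phi a b); auto.
  - rewrite H. reflexivity.
  - apply (eq_is_derive phi b a); auto.
Qed.

(** * Compactly supported functions and their gradients *)

(** Only the values off the disc are constrained, not the support, because this
    condition passes to linear combinations at once and is all that the
    truncation of ray integrals requires. *)
Definition Cc (r : R) (F : vec -> R) : Prop :=
  (forall x y, continuity_2d_pt (fun s t => F (s, t)) x y) /\
  (forall p, ~ disc r p -> F p = 0).

(** The partial derivatives [hx] and [hy] are arguments, so that the gradient of
    a linear combination is known without computing a [Derive]. *)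
Definition C1c (r : R) (h hx hy : vec -> R) : Prop :=
  (forall x y, differentiable_pt_lim (fun s t => h (s, t)) x y (hx (x, y)) (hy (x, y))) /\
  Cc r h /\ Cc r hx /\ Cc r hy.

Definition ddir (a : vec) (hx hy : vec -> R) (p : vec) : R :=
  fst a * hx p + snd a * hy p.

(** Off the disc, hence off the support, [h] vanishes on a neighbourhood, so its
    partial derivatives vanish there too. Continuity of the partial derivatives
    gives differentiability. *)
Lemma Cc2_C1c (r : R) (h : vec -> R) :
  Cc2 r h -> exists hx hy, C1c r h hx hy.
Proof.
  intros [Hd Hs].
  set (hx := fun p : vec => Derive (fun z => h (z, snd p)) (fst p)).
  set (hy := fun p : vec => Derive (fun z => h (fst p, z)) (snd p)).
  exists hx, hy.
  assert (Hz : forall p : vec, ~ disc r p -> exists eps : posreal, forall q : vec, ball p eps q -> h q = 0).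
  { intros p Hp. apply NNPP. intros H. apply Hp, Hs. intros eps.
    apply NNPP. intros H'. apply H. exists eps. intros q Hq.
    apply NNPP. intros H''. apply H'. exists q. split; assumption. }
  split; [|split; [|split]].
  - intros x y.
    apply (filterdiff_differentiable_pt_lim (fun s t => h (s, t))).
    apply (is_derive_filterdiff (fun s t => h (s, t)) x y (fun s t => hx (s, t)) (hy (x, y))).
    + apply filter_forall. intros [s t]. simpl.
      apply Derive_correct. apply (Hd s t).
    + apply Derive_correct. apply (Hd x y).
    + apply (continuity_2d_pt_filterlim (fun s t => hx (s, t))).
      apply (Hd x y).
  - split.
    + intros x y. apply (Hd x y).
    + intros p Hp. destruct (Hz p Hp) as [eps He]. apply He, ball_center.
  - split.
    + intros x y. apply (Hd x y).
    + intros [x y] Hp. destruct (Hz _ Hp) as [eps He]. unfold hx; simpl.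
      rewrite (Derive_ext_loc _ (fun _ => 0)); [apply Derive_const|].
      exists eps. intros s Hs'. apply He. split; [exact Hs' | apply ball_center].
  - split.
    + intros x y. apply (Hd x y).
    + intros [x y] Hp. destruct (Hz _ Hp) as [eps He]. unfold hy; simpl.
      rewrite (Derive_ext_loc _ (fun _ => 0)); [apply Derive_const|].
      exists eps. intros s Hs'. apply He. split; [apply ball_center | exact Hs'].
Qed.

Lemma Cc_lin (r al be : R) (F G : vec -> R) :
  Cc r F -> Cc r G -> Cc r (fun p => al * F p + be * G p).
Proof.
  intros [HF HF0] [HG HG0]. split.
  - intros x y. apply continuity_2d_pt_plus; apply continuity_2d_pt_mult;
      try apply continuity_2d_pt_const; auto.
  - intros p Hp. rewrite HF0, HG0 by assumption. ring.
Qed.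

Lemma C1c_lin (r al be : R) (h hx hy k kx ky : vec -> R) :
  C1c r h hx hy -> C1c r k kx ky ->
  C1c r (fun p => al * h p + be * k p) (fun p => al * hx p + be * kx p)
        (fun p => al * hy p + be * ky p).
Proof.
  intros (H & H0 & H1 & H2) (K & K0 & K1 & K2).
  split; [|split; [|split]]; try (apply Cc_lin; assumption).
  intros x y.
  assert (Hlin : differentiable_pt_lim (fun u v => al * u + be * v) (h (x, y)) (k (x, y)) al be).
  { intros eps. exists (mkposreal 1 Rlt_0_1). intros u v _ _.
    replace (al * u + be * v - (al * h (x, y) + be * k (x, y)) -
      (al * (u - h (x, y)) + be * (v - k (x, y)))) with 0 by ring.
    rewrite Rabs_R0. apply Rmult_le_pos; [left; apply cond_pos|].
    apply Rle_trans with (2 := Rmax_l _ _). apply Rabs_pos. }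
  apply (differentiable_pt_lim_comp (fun u v => al * u + be * v) (fun s t => h (s, t))
    (fun s t => k (s, t)) x y al be _ _ _ _ Hlin (H x y) (K x y)).
Qed.

Lemma along_0 (x a : vec) : along x a 0 = x.
Proof. unfold along. rewrite !Rmult_0_l, !Rplus_0_r. symmetry. apply surjective_pairing. Qed.

Lemma C1c_along (r : R) (h hx hy : vec -> R) (x a : vec) (t : R) :
  C1c r h hx hy ->
  is_derive (fun t => h (along x a t)) t (ddir a hx hy (along x a t)).
Proof.
  intros (H & _). apply is_derive_Reals.
  replace (ddir a hx hy (along x a t))
    with (hx (along x a t) * fst a + hy (along x a t) * snd a) by (unfold ddir; ring).
  apply (derivable_pt_lim_comp_2d (fun s t => h (s, t)) (fun t => fst x + t * fst a)
    (fun t => snd x + t * snd a)).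
  - apply H.
  - apply is_derive_Reals. auto_derive; [exact I | ring].
  - apply is_derive_Reals. auto_derive; [exact I | ring].
Qed.

Lemma C1c_ddir (r : R) (h hx hy : vec -> R) (a : vec) :
  C1c r h hx hy -> Cc r (ddir a hx hy).
Proof. intros (_ & _ & Hx & Hy). apply (Cc_lin r (fst a) (snd a) hx hy Hx Hy). Qed.

Lemma Cc_along (r : R) (F : vec -> R) (x a : vec) (t : R) :
  Cc r F -> continuous (fun t => F (along x a t)) t.
Proof.
  intros [HF _].
  apply (continuous_comp_2 (fun t => fst x + t * fst a) (fun t => snd x + t * snd a)
    (fun s t => F (s, t))).
  - apply (ex_derive_continuous (V := R_NormedModule)). auto_derive; exact I.
  - apply (ex_derive_continuous (V := R_NormedModule)). auto_derive; exact I.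
  - apply (continuity_2d_pt_filterlim (fun s t => F (s, t))), HF.
Qed.

Lemma ex_RInt_along (r : R) (F : vec -> R) (x a : vec) (p q : R) :
  Cc r F -> ex_RInt (fun t => F (along x a t)) p q.
Proof.
  intros HF. apply (ex_RInt_continuous (V := R_CompleteNormedModule)).
  intros z _. apply (Cc_along r), HF.
Qed.

(** * Ray transforms of compactly supported functions *)

(** Rays that start in a bounded set leave the disc before a common time, provided
    that their speeds are bounded below: [|y + t a|^2 >= t^2 |a|^2 / 2 - |y|^2].
    The uniformity lets one truncate a whole family of ray transforms at the
    same [T], before differentiating or integrating in the parameter. *)
Lemma disc_escape (r m B : R) :
  0 < m ->
  exists T, 0 <= T /\ forall (y a : vec) (t : R),
    (fst y) ^ 2 + (snd y) ^ 2 <= B -> m <= (fst a) ^ 2 + (snd a) ^ 2 -> T <= t ->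
    ~ disc r (along y a t).
Proof.
  (* The absolute value makes the bound nonnegative even if [B] is negative. *)
  intros Hm. set (C := Rabs (r ^ 2 + B)).
  assert (HC : 0 <= C) by apply Rabs_pos.
  assert (HC' : r ^ 2 + B <= C) by apply Rle_abs.
  assert (HT : 0 <= 2 * C / m).
  { apply Rmult_le_pos; [lra | left; apply Rinv_0_lt_compat, Hm]. }
  exists (1 + 2 * C / m). split; [lra|].
  intros [y1 y2] [a1 a2] t. unfold disc, along; simpl fst; simpl snd.
  intros Hy Ha Ht Hdisc.
  assert (H1 : 2 * C <= t * m).
  { replace (2 * C) with ((2 * C / m) * m) by (field; lra).
    apply Rmult_le_compat_r; lra. }
  assert (H2 : t * m <= t ^ 2 * m) by nra.
  assert (H3 : t ^ 2 * m <= t ^ 2 * (a1 ^ 2 + a2 ^ 2)) by nra.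
  (* [2 |y + t a|^2 + 2 |y|^2 - t^2 |a|^2 = |2 y + t a|^2]. *)
  assert (H4 : 0 <= (2 * y1 + t * a1) ^ 2 + (2 * y2 + t * a2) ^ 2)
    by (apply Rplus_le_le_0_compat; apply pow2_ge_0).
  nra.
Qed.

Lemma Xray_trunc (r : R) (F : vec -> R) (x a : vec) (T : R) :
  Cc r F -> 0 <= T -> (forall t, T <= t -> ~ disc r (along x a t)) ->
  Xray a F x = RInt (fun t => F (along x a t)) 0 T.
Proof.
  intros HF HT Hout. unfold Xray.
  apply (is_RInt_gen_unique (V := R_CompleteNormedModule)).
  set (g := fun t => F (along x a t)).
  assert (Hex : forall p q, ex_RInt g p q).
  { intros p q. apply (ex_RInt_along r), HF. }
  intros P [eps HP].
  exists (fun u => u = 0) (fun v => T < v).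
  - reflexivity.
  - exists T. auto.
  - intros u v -> Hv. exists (RInt g 0 T). split.
    + simpl. replace (RInt g 0 T) with (plus (RInt g 0 T) (RInt g T v)).
      * apply (is_RInt_Chasles (V := R_NormedModule)) with T;
          apply (RInt_correct (V := R_CompleteNormedModule)), Hex.
      * rewrite (RInt_ext (V := R_CompleteNormedModule) g (fun _ => 0) T v).
        -- rewrite RInt_const. unfold plus, scal; simpl; unfold mult; simpl. ring.
        -- intros t Ht. rewrite Rmin_left in Ht by lra. apply HF, Hout. lra.
    + apply HP, ball_center.
Qed.

Lemma norm2_pos (a : vec) : a <> (0, 0) -> 0 < (fst a) ^ 2 + (snd a) ^ 2.
Proof.
  destruct a as [a1 a2]; simpl fst; simpl snd. intros Ha.
  destruct (Req_dec a1 0) as [H1 | H1]; [destruct (Req_dec a2 0) as [H2 | H2] |].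
  - subst. now elim Ha.
  - assert (0 < a2 ^ 2) by (apply pow2_gt_0; exact H2). nra.
  - assert (0 < a1 ^ 2) by (apply pow2_gt_0; exact H1). nra.
Qed.

Lemma ray_escape (r : R) (x a : vec) :
  a <> (0, 0) -> exists T, 0 <= T /\ forall t, T <= t -> ~ disc r (along x a t).
Proof.
  intros Ha.
  destruct (disc_escape r _ ((fst x) ^ 2 + (snd x) ^ 2) (norm2_pos a Ha)) as [T [HT Hout]].
  exists T. split; [exact HT|].
  intros t Ht. apply Hout; [apply Rle_refl | apply Rle_refl | exact Ht].
Qed.

Lemma Xray_lin (r al be : R) (F G : vec -> R) (x a : vec) :
  Cc r F -> Cc r G -> a <> (0, 0) ->
  Xray a (fun p => al * F p + be * G p) x = al * Xray a F x + be * Xray a G x.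
Proof.
  intros HF HG Ha.
  destruct (ray_escape r x a Ha) as [T [HT Hout]].
  rewrite (Xray_trunc r _ x a T (Cc_lin r al be F G HF HG) HT Hout).
  rewrite (Xray_trunc r F x a T HF HT Hout), (Xray_trunc r G x a T HG HT Hout).
  apply (is_RInt_unique (V := R_CompleteNormedModule)).
  apply (is_RInt_plus (V := R_NormedModule));
    apply (is_RInt_scal (V := R_NormedModule));
    apply (RInt_correct (V := R_CompleteNormedModule)), (ex_RInt_along r); assumption.
Qed.

(** The integral of the derivative along the ray runs from [h x] to [0]. *)
Lemma Xray_ddir_self (r : R) (h hx hy : vec -> R) (x a : vec) :
  C1c r h hx hy -> a <> (0, 0) -> Xray a (ddir a hx hy) x = - h x.
Proof.
  intros H Ha.
  destruct (ray_escape r x a Ha) as [T [HT Hout]].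
  rewrite (Xray_trunc r _ x a T (C1c_ddir r h hx hy a H) HT Hout).
  apply (is_RInt_unique (V := R_CompleteNormedModule)).
  replace (- h x) with (minus (h (along x a T)) (h (along x a 0))).
  - apply (is_RInt_derive (V := R_CompleteNormedModule) (fun t => h (along x a t))).
    + intros t _. apply (C1c_along r), H.
    + intros t _. apply (Cc_along r), (C1c_ddir r h), H.
  - destruct H as (_ & [_ H0] & _). rewrite (H0 (along x a T)) by (apply Hout, Rle_refl).
    rewrite along_0. unfold minus, plus, opp; simpl. ring.
Qed.

(** Moving the starting point along the ray shifts the interval of integration, so
    only the value of [F] at the starting point is lost. This applies to [D_v g]
    for a C^1 function [g], which is merely continuous. *)
Lemma is_derive_Xray_self (r : R) (F : vec -> R) (x u : vec) :
  Cc r F -> u <> (0, 0) ->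
  is_derive (fun s => Xray u F (along x u s)) 0 (- F x).
Proof.
  intros HF Hu.
  destruct (ray_escape r x u Hu) as [T [HT Hout]].
  set (g := fun t => F (along x u t)).
  assert (Hex : forall p q, ex_RInt g p q).
  { intros p q. apply (ex_RInt_along r), HF. }
  (* Started at [along x u s], the ray is outside the disc from time [T - s] on, and
     [T - s < T + 1]. *)
  assert (Hshift : forall s, -1 < s < 1 -> Xray u F (along x u s) = RInt g s (T + 1 + s)).
  { intros s Hs.
    assert (Hal : forall t, along (along x u s) u t = along x u (1 * t + s)).
    { intros t. unfold along; simpl. f_equal; ring. }
    rewrite (Xray_trunc r F _ u (T + 1) HF); [| lra |].
    - rewrite (RInt_ext _ (fun t => scal 1 (g (1 * t + s)))).
      + etransitivity.
        * apply (RInt_comp_lin (V := R_CompleteNormedModule) g 1 s 0 (T + 1)), Hex.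
        * f_equal; ring.
      + intros t _. rewrite Hal. unfold g, scal; simpl; unfold mult; simpl. ring.
    - intros t Ht. rewrite Hal. apply Hout. lra. }
  (* [g] vanishes from [T] on, so the upper bound can be frozen. *)
  apply (is_derive_ext_loc (fun s => RInt g s (T + 2))).
  - exists (mkposreal 1 Rlt_0_1). intros s Hs.
    change (Rabs (s - 0) < 1) in Hs. apply Rabs_lt_between in Hs.
    rewrite Hshift by lra.
    rewrite <- (RInt_Chasles g s (T + 1 + s) (T + 2)) by apply Hex.
    rewrite (RInt_ext (V := R_CompleteNormedModule) g (fun _ => 0) (T + 1 + s) (T + 2)).
    + rewrite RInt_const. unfold plus, scal; simpl; unfold mult; simpl. ring.
    + intros t Ht. rewrite Rmin_left in Ht by lra. apply HF, Hout. lra.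
  - replace (- F x) with (opp (g 0)).
    + apply (is_derive_RInt' (V := R_NormedModule) g _ 0 (T + 2)).
      * apply filter_forall. intros s. apply (RInt_correct (V := R_CompleteNormedModule)), Hex.
      * apply (Cc_along r), HF.
    + unfold g. rewrite along_0. reflexivity.
Qed.

(** Differentiation under the integral sign; for [-1 < s < 1] the rays starting at
    [along x v s] all leave the disc by the same time. *)
Lemma is_derive_Xray (r : R) (h hx hy : vec -> R) (x u v : vec) :
  C1c r h hx hy -> u <> (0, 0) ->
  is_derive (fun s => Xray u h (along x v s)) 0 (Xray u (ddir v hx hy) x).
Proof.
  intros H Hu.
  pose proof (C1c_ddir r h hx hy v H) as HD.
  assert (Hh : Cc r h) by apply H.
  (* [|x + s v|^2 <= 2 (|x|^2 + |v|^2)] when [s^2 <= 1]. *)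
  set (B := 2 * ((fst x) ^ 2 + (snd x) ^ 2 + (fst v) ^ 2 + (snd v) ^ 2)).
  destruct (disc_escape r _ B (norm2_pos u Hu)) as [T [HT Hout]].
  assert (Hb : forall s, -1 < s < 1 -> (fst (along x v s)) ^ 2 + (snd (along x v s)) ^ 2 <= B).
  { intros s Hs. unfold B, along; simpl fst; simpl snd.
    destruct x as [x1 x2], v as [v1 v2]; simpl fst; simpl snd.
    assert (0 <= 1 - s ^ 2) by nra.
    assert (0 <= (1 - s ^ 2) * v1 ^ 2) by nra.
    assert (0 <= (1 - s ^ 2) * v2 ^ 2) by nra.
    pose proof (pow2_ge_0 (x1 - s * v1)).
    pose proof (pow2_ge_0 (x2 - s * v2)).
    nra. }
  set (f := fun s t => h (along (along x v s) u t)).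
  assert (Hal : forall s t, along (along x v s) u t = along (along x u t) v s).
  { intros s t. unfold along; simpl. f_equal; ring. }
  assert (Hf : forall s t, is_derive (fun s => f s t) s (ddir v hx hy (along (along x v s) u t))).
  { intros s t. rewrite Hal.
    apply (is_derive_ext (fun s => h (along (along x u t) v s))).
    - intros z. unfold f. now rewrite Hal.
    - apply (C1c_along r), H. }
  apply (is_derive_ext_loc (fun s => RInt (fun t => f s t) 0 T)).
  - exists (mkposreal 1 Rlt_0_1). intros s Hs.
    change (Rabs (s - 0) < 1) in Hs. apply Rabs_lt_between in Hs.
    symmetry. apply (Xray_trunc r); [exact Hh | exact HT |].
    intros t Ht. apply Hout; [apply Hb; lra | apply Rle_refl | exact Ht].
  - rewrite (Xray_trunc r _ x u T HD HT).
    + replace (RInt (fun t => ddir v hx hy (along x u t)) 0 T)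
        with (RInt (fun t => Derive (fun s => f s t) 0) 0 T).
      * apply (is_derive_RInt_param f).
        -- apply filter_forall. intros s t _. eexists. apply Hf.
        -- intros t _.
           apply (continuity_2d_pt_ext (fun s t => ddir v hx hy (along (along x v s) u t))).
           { intros s z. symmetry. apply is_derive_unique, Hf. }
           apply (continuity_2d_pt_comp_2d (fun p q => ddir v hx hy (p, q))
             (fun s t => fst x + s * fst v + t * fst u) (fun s t => snd x + s * snd v + t * snd u)).
           { apply HD. }
           { continuity_2d. }
           { continuity_2d. }
        -- apply filter_forall. intros s.
           apply (ex_RInt_along r), Hh.
      * apply RInt_ext. intros t _.
        transitivity (ddir v hx hy (along (along x v 0) u t)).
        -- apply is_derive_unique, Hf.
        -- now rewrite along_0.
    + intros t Ht. rewrite <- (along_0 x v). apply Hout; [apply Hb; lra | apply Rle_refl | exact Ht].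
Qed.

(** * From the data to differential equations *)

(** After [D_v] the first ray transform still has an integral and the second one
    has become [- h]; the outer [D_u] then removes the remaining integral. *)
Lemma Ddir_Ddir_vline (r : R) (g gx gy h hx hy : vec -> R) (u v : vec) :
  C1c r g gx gy -> C1c r h hx hy -> u <> (0, 0) -> v <> (0, 0) ->
  Ddir u (Ddir v (fun y => Xray u g y + Xray v h y)) =
  (fun x => - (ddir v gx gy x + ddir u hx hy x)).
Proof.
  intros Hg Hh Hu Hv.
  assert (Hin : Ddir v (fun y => Xray u g y + Xray v h y)
                = (fun y => Xray u (ddir v gx gy) y - h y)).
  { apply functional_extensionality. intros y.
    apply is_derive_unique.
    apply (is_derive_plus (V := R_NormedModule) (fun s => Xray u g (along y v s))).
    - apply (is_derive_Xray r), Hu. exact Hg.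
    - apply (is_derive_Xray_self r); [apply Hh | exact Hv]. }
  rewrite Hin.
  apply functional_extensionality. intros x.
  apply is_derive_unique.
  replace (- (ddir v gx gy x + ddir u hx hy x))
    with (minus (- ddir v gx gy x) (ddir u hx hy (along x u 0))).
  - apply (is_derive_minus (V := R_NormedModule)
      (fun s => Xray u (ddir v gx gy) (along x u s))).
    + apply (is_derive_Xray_self r); [apply (C1c_ddir r g), Hg | exact Hu].
    + apply (C1c_along r), Hh.
  - rewrite along_0. unfold minus, plus, opp; simpl. ring.
Qed.

Lemma Cc_ext (r : R) (F G : vec -> R) :
  Cc r F -> (forall p, F p = G p) -> Cc r G.
Proof. intros H E. now rewrite <- (functional_extensionality F G E). Qed.

Lemma C1c_ext (r : R) (h hx hy k : vec -> R) :
  C1c r h hx hy -> (forall p, h p = k p) -> C1c r k hx hy.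
Proof. intros H E. now rewrite <- (functional_extensionality h k E). Qed.

(** Besides [Ddir_Ddir_vline] this uses [D_u + D_v = 2 u2 d/dx2],
    [D_u - D_v = 2 u1 d/dx1], and the values of the integrands in terms of the
    trace, [d] and [k]: on the branch [u], they are the trace for [L + T],
    [s d + 2 u1 u2 k] for [L - T] and [- u1 u2 d + (s / 2) k] for [M]; on the
    branch [v] the sign of [u1 u2] changes. *)
Lemma vline_data (r u1 u2 : R) (f : vec -> sym2) :
  unit_vec (u1, u2) -> u1 <> 0 -> Cc2_sym2 r f ->
  let DD h := Ddir (u1, u2) (Ddir (- u1, u2) h) in
  let L := Lvline (u1, u2) (- u1, u2) f in
  let T := Tvline (u1, u2) (- u1, u2) f in
  let M := Mvline (u1, u2) (- u1, u2) f in
  let s := u1 ^ 2 - u2 ^ 2 in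
  exists ex ey dx dy kx ky : vec -> R,
    C1c r (fun p => c11 (f p) + c22 (f p)) ex ey /\
    C1c r (fun p => c11 (f p) - c22 (f p)) dx dy /\
    C1c r (fun p => 2 * c12 (f p)) kx ky /\
    DD (fun y => L y + T y) = (fun p => - (2 * u2) * ey p) /\
    DD (fun y => L y - T y) = (fun p => - (2 * u2) * (s * dy p - 2 * u1 ^ 2 * kx p)) /\
    DD M = (fun p => - u2 * (2 * u1 ^ 2 * dx p + s * ky p)).
Proof.
  intros Hu H1 (Hf11 & Hf12 & Hf22). cbv zeta.
  unfold unit_vec in Hu; simpl fst in Hu; simpl snd in Hu.
  destruct (Cc2_C1c r _ Hf11) as (ax & ay & Ha).
  destruct (Cc2_C1c r _ Hf12) as (bx & by_ & Hb).
  destruct (Cc2_C1c r _ Hf22) as (cx & cy & Hc).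
  pose proof (C1c_lin r 1 1 _ _ _ _ _ _ Ha Hc) as He.
  pose proof (C1c_lin r 1 (-1) _ _ _ _ _ _ Ha Hc) as Hd.
  pose proof (C1c_lin r 2 0 _ _ _ _ _ _ Hb Hb) as Hk.
  eapply C1c_ext in He; [|intros p; instantiate (1 := fun p => c11 (f p) + c22 (f p)); simpl; ring].
  eapply C1c_ext in Hd; [|intros p; instantiate (1 := fun p => c11 (f p) - c22 (f p)); simpl; ring].
  eapply C1c_ext in Hk; [|intros p; instantiate (1 := fun p => 2 * c12 (f p)); simpl; ring].
  eexists _, _, _, _, _, _.
  split; [exact He|]. split; [exact Hd|]. split; [exact Hk|].
  assert (Hun : (u1, u2) <> (0, 0)) by congruence.
  assert (Hvn : (- u1, u2) <> (0, 0)) by (intros E; injection E; lra).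
  assert (Hin : forall g, Cc r (fun p => inner (f p) g)).
  { intros g.
    pose proof (C1c_lin r (c11 g) 1 _ _ _ _ _ _ Ha
      (C1c_lin r (2 * c12 g) (c22 g) _ _ _ _ _ _ Hb Hc)) as H.
    eapply C1c_ext in H; [apply H|]. intros p. unfold inner. ring. }
  assert (Hsum : forall a g g', a <> (0, 0) -> forall al y,
    Xray a (fun p => inner (f p) g) y + al * Xray a (fun p => inner (f p) g') y
    = Xray a (fun p => inner (f p) g + al * inner (f p) g') y).
  { intros a g g' Han al y.
    rewrite <- (Rmult_1_l (Xray a (fun p => inner (f p) g) y)).
    rewrite <- (Xray_lin r 1 al _ _ y a (Hin g) (Hin g') Han).
    f_equal. apply functional_extensionality. intros p. ring. }
  set (U := (u1, u2)) in *. set (V := (- u1, u2)) in *.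
  split; [|split].
  - assert (E : (fun y => Lvline U V f y + Tvline U V f y)
      = (fun y => Xray U (fun p => c11 (f p) + c22 (f p)) y
                  + Xray V (fun p => c11 (f p) + c22 (f p)) y)).
    { apply functional_extensionality. intros y. unfold Lvline, Tvline.
      transitivity ((Xray U (fun p => inner (f p) (odot U U)) y
          + 1 * Xray U (fun p => inner (f p) (odot (perp U) (perp U))) y)
        + (Xray V (fun p => inner (f p) (odot V V)) y
          + 1 * Xray V (fun p => inner (f p) (odot (perp V) (perp V))) y)); [ring|].
      rewrite !Hsum by assumption.
      f_equal; f_equal; apply functional_extensionality; intros p;
        (transitivity ((u1 ^ 2 + u2 ^ 2) * (c11 (f p) + c22 (f p))); [|rewrite Hu; ring]);
        unfold inner, odot, perp; simpl; field. }
    rewrite E, (Ddir_Ddir_vline r _ _ _ _ _ _ U V He He Hun Hvn).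
    apply functional_extensionality. intros p. unfold ddir; simpl. ring.
  - pose proof (C1c_lin r (u1 ^ 2 - u2 ^ 2) (2 * u1 * u2) _ _ _ _ _ _ Hd Hk) as Hg.
    pose proof (C1c_lin r (u1 ^ 2 - u2 ^ 2) (- (2 * u1 * u2)) _ _ _ _ _ _ Hd Hk) as Hh.
    assert (E : (fun y => Lvline U V f y - Tvline U V f y)
      = (fun y =>
          Xray U (fun p => (u1 ^ 2 - u2 ^ 2) * (c11 (f p) - c22 (f p))
                           + 2 * u1 * u2 * (2 * c12 (f p))) y
          + Xray V (fun p => (u1 ^ 2 - u2 ^ 2) * (c11 (f p) - c22 (f p))
                           + - (2 * u1 * u2) * (2 * c12 (f p))) y)).
    { apply functional_extensionality. intros y. unfold Lvline, Tvline.
      transitivity ((Xray U (fun p => inner (f p) (odot U U)) y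
          + - (1) * Xray U (fun p => inner (f p) (odot (perp U) (perp U))) y)
        + (Xray V (fun p => inner (f p) (odot V V)) y
          + - (1) * Xray V (fun p => inner (f p) (odot (perp V) (perp V))) y)); [ring|].
      rewrite !Hsum by assumption.
      f_equal; f_equal; apply functional_extensionality; intros p;
        unfold inner, odot, perp; simpl; field. }
    rewrite E, (Ddir_Ddir_vline r _ _ _ _ _ _ U V Hg Hh Hun Hvn).
    apply functional_extensionality. intros p. unfold ddir; simpl. ring.
  - pose proof (C1c_lin r (- (u1 * u2)) ((u1 ^ 2 - u2 ^ 2) / 2) _ _ _ _ _ _ Hd Hk) as Hg.
    pose proof (C1c_lin r (u1 * u2) ((u1 ^ 2 - u2 ^ 2) / 2) _ _ _ _ _ _ Hd Hk) as Hh.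
    assert (E : Mvline U V f
      = (fun y =>
          Xray U (fun p => - (u1 * u2) * (c11 (f p) - c22 (f p))
                           + (u1 ^ 2 - u2 ^ 2) / 2 * (2 * c12 (f p))) y
          + Xray V (fun p => u1 * u2 * (c11 (f p) - c22 (f p))
                           + (u1 ^ 2 - u2 ^ 2) / 2 * (2 * c12 (f p))) y)).
    { apply functional_extensionality. intros y. unfold Mvline.
      f_equal; f_equal; apply functional_extensionality; intros p;
        unfold inner, odot, perp; simpl; field. }
    rewrite E, (Ddir_Ddir_vline r _ _ _ _ _ _ U V Hg Hh Hun Hvn).
    apply functional_extensionality. intros p. unfold ddir; simpl. field.
Qed.

(** * Integration over an ellipse of directions *)

Definition ellipse (A B th : R) : vec := (A * cos th, B * sin th).

(** The derivative of [ellipse A B] in the angle. *)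
Definition ellipse' (A B th : R) : vec := (- (A * sin th), B * cos th).

(** This lower bound, uniform in the angle, is what [disc_escape] needs to truncate
    all rays from [x] at the same time. *)
Lemma ellipse_norm2 (A B th : R) :
  Rmin (A ^ 2) (B ^ 2) <= (fst (ellipse A B th)) ^ 2 + (snd (ellipse A B th)) ^ 2.
Proof.
  simpl fst; simpl snd.
  pose proof (sin2_cos2 th) as H. unfold Rsqr in H.
  pose proof (Rmin_l (A ^ 2) (B ^ 2)). pose proof (Rmin_r (A ^ 2) (B ^ 2)).
  replace (Rmin (A ^ 2) (B ^ 2))
    with (Rmin (A ^ 2) (B ^ 2) * cos th ^ 2 + Rmin (A ^ 2) (B ^ 2) * sin th ^ 2)
    by (replace (sin th ^ 2) with (1 - cos th ^ 2) by (simpl; lra); ring).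
  rewrite !Rpow_mult_distr.
  apply Rplus_le_compat; apply Rmult_le_compat_r; try apply pow2_ge_0; assumption.
Qed.

Lemma ellipse_neq0 (A B th : R) : A <> 0 -> B <> 0 -> ellipse A B th <> (0, 0).
Proof.
  intros HA HB H. pose proof (ellipse_norm2 A B th) as Hn. rewrite H in Hn. simpl fst in Hn; simpl snd in Hn.
  assert (0 < Rmin (A ^ 2) (B ^ 2)) by (apply Rmin_glb_lt; apply pow2_gt_0; assumption).
  lra.
Qed.

(** Up to the factor [t] the integrand is the angular derivative of
    [k (along x (ellipse A B th) t)]. For [t = 0] that factor is lost, but the
    gradient is then frozen at [x], and the integrand is the derivative of the
    periodic function [phi] below. *)
Lemma RInt_ellipse_tangent (r A B t : R) (k kx ky : vec -> R) (x : vec) :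
  C1c r k kx ky ->
  RInt (fun th => ddir (ellipse' A B th) kx ky (along x (ellipse A B th) t)) 0 (2 * PI) = 0.
Proof.
  intros (Hk & _ & [Hkx _] & [Hky _]).
  assert (HcX : forall th, continuous (fun th => fst x + t * (A * cos th)) th).
  { intros th. apply (ex_derive_continuous (V := R_NormedModule)). auto_derive; exact I. }
  assert (HcY : forall th, continuous (fun th => snd x + t * (B * sin th)) th).
  { intros th. apply (ex_derive_continuous (V := R_NormedModule)). auto_derive; exact I. }
  assert (Hcont : forall th, continuous
    (fun th => ddir (ellipse' A B th) kx ky (along x (ellipse A B th) t)) th).
  { intros th. apply (continuous_plus (V := R_NormedModule));
      apply (continuous_mult (K := R_AbsRing)).
    - apply (ex_derive_continuous (V := R_NormedModule) (fun th => - (A * sin th))).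
      auto_derive; exact I.
    - apply (continuous_comp_2 (fun th => fst x + t * (A * cos th))
        (fun th => snd x + t * (B * sin th)) (fun p q => kx (p, q))); auto.
      apply (continuity_2d_pt_filterlim (fun p q => kx (p, q))), Hkx.
    - apply (ex_derive_continuous (V := R_NormedModule) (fun th => B * cos th)).
      auto_derive; exact I.
    - apply (continuous_comp_2 (fun th => fst x + t * (A * cos th))
        (fun th => snd x + t * (B * sin th)) (fun p q => ky (p, q))); auto.
      apply (continuity_2d_pt_filterlim (fun p q => ky (p, q))), Hky. }
  apply (is_RInt_unique (V := R_CompleteNormedModule)).
  destruct (Req_dec t 0) as [-> | Ht].
  - set (phi := fun th => A * cos th * kx x + B * sin th * ky x).
    replace 0 with (minus (phi (2 * PI)) (phi 0)) at 2.
    + apply (is_RInt_derive (V := R_CompleteNormedModule) phi); [|intros; apply Hcont].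
      intros th _. unfold phi, ddir, along. rewrite !Rmult_0_l, !Rplus_0_r.
      rewrite <- surjective_pairing. simpl fst; simpl snd.
      auto_derive; [exact I | ring].
    + unfold phi. rewrite cos_2PI, sin_2PI, cos_0, sin_0. unfold minus, plus, opp; simpl. ring.
  - set (phi := fun th => / t * k (along x (ellipse A B th) t)).
    replace 0 with (minus (phi (2 * PI)) (phi 0)) at 2.
    + apply (is_RInt_derive (V := R_CompleteNormedModule) phi); [|intros; apply Hcont].
      intros th _. unfold phi.
      set (p := along x (ellipse A B th) t).
      replace (ddir (ellipse' A B th) kx ky p)
        with (/ t * (kx p * (t * - (A * sin th)) + ky p * (t * (B * cos th))))
        by (unfold ddir, ellipse'; simpl fst; simpl snd; field; exact Ht).
      apply (is_derive_scal (fun th => k (along x (ellipse A B th) t))).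
      apply is_derive_Reals.
      apply (derivable_pt_lim_comp_2d (fun s t => k (s, t))
        (fun th => fst x + t * (A * cos th)) (fun th => snd x + t * (B * sin th))).
      * apply Hk.
      * apply is_derive_Reals. auto_derive; [exact I | ring].
      * apply is_derive_Reals. auto_derive; [exact I | ring].
    + unfold phi, ellipse. rewrite cos_2PI, sin_2PI, cos_0, sin_0.
      apply (minus_eq_zero (G := R_AbelianGroup)).
Qed.

(** The derivative [D_{a'} k] has no [1/t] singularity at the centre, so Fubini
    applies on the whole rectangle [0, 2 PI] x [0, T] and the vanishing of
    the inner integrals over [th] suffices. *)
Lemma is_RInt_Xray_tangent (r A B : R) (k kx ky : vec -> R) (x : vec) :
  C1c r k kx ky -> A <> 0 -> B <> 0 ->
  is_RInt (fun th => Xray (ellipse A B th) (ddir (ellipse' A B th) kx ky) x) 0 (2 * PI) 0.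
Proof.
  intros Hk HA HB.
  assert (Hm : 0 < Rmin (A ^ 2) (B ^ 2)) by (apply Rmin_glb_lt; apply pow2_gt_0; assumption).
  destruct (disc_escape r _ ((fst x) ^ 2 + (snd x) ^ 2) Hm) as [T [HT Hout]].
  set (G := fun th t => ddir (ellipse' A B th) kx ky (along x (ellipse A B th) t)).
  assert (HG : forall th t, continuity_2d_pt G th t).
  { intros th t. destruct Hk as (_ & _ & [Hkx _] & [Hky _]).
    assert (HX : continuity_2d_pt (fun th t => fst x + t * (A * cos th)) th t).
    { continuity_2d. }
    assert (HY : continuity_2d_pt (fun th t => snd x + t * (B * sin th)) th t).
    { continuity_2d. }
    apply continuity_2d_pt_plus; apply continuity_2d_pt_mult.
    - simpl fst. continuity_2d.
    - apply (continuity_2d_pt_comp_2d (fun p q => kx (p, q))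
        (fun th t => fst x + t * (A * cos th)) (fun th t => snd x + t * (B * sin th))); auto.
    - simpl snd. continuity_2d.
    - apply (continuity_2d_pt_comp_2d (fun p q => ky (p, q))
        (fun th t => fst x + t * (A * cos th)) (fun th t => snd x + t * (B * sin th))); auto. }
  apply (is_RInt_ext (fun th => RInt (G th) 0 T)).
  { intros th _. symmetry. apply (Xray_trunc r).
    - apply (C1c_ddir r k), Hk.
    - exact HT.
    - intros t Ht. apply Hout; [apply Rle_refl | apply ellipse_norm2 | exact Ht]. }
  replace 0 with (RInt (fun th => RInt (G th) 0 T) 0 (2 * PI)) at 2.
  - apply (RInt_correct (V := R_CompleteNormedModule)).
    apply (ex_RInt_continuous (V := R_CompleteNormedModule)).
    intros th _. apply continuous_RInt_param, HG.
  - rewrite (RInt_fubini G 0 (2 * PI) 0 T HG).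
    rewrite (RInt_ext _ (fun _ => 0)).
    + rewrite RInt_const. unfold scal; simpl; unfold mult; simpl. ring.
    + intros t _. apply (RInt_ellipse_tangent r A B t k kx ky x Hk).
Qed.

(** The Cauchy-Pompeiu formula in elliptic polar coordinates: the radial part
    reproduces the value at the centre and the tangential part drops out. *)
Lemma RInt_ellipse_reconstruct (r A B c e : R) (h hx hy k kx ky : vec -> R) (x : vec) :
  C1c r h hx hy -> C1c r k kx ky -> A <> 0 -> B <> 0 ->
  RInt (fun th => Xray (ellipse A B th)
          (fun p => c * ddir (ellipse A B th) hx hy p + e * ddir (ellipse' A B th) kx ky p) x)
    0 (2 * PI) = - (2 * PI * c) * h x.
Proof.
  intros Hh Hk HA HB.
  apply (is_RInt_unique (V := R_CompleteNormedModule)).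
  apply (is_RInt_ext (fun th => plus (c * - h x)
    (scal e (Xray (ellipse A B th) (ddir (ellipse' A B th) kx ky) x)))).
  - intros th _. pose proof (ellipse_neq0 A B th HA HB) as Hn.
    rewrite (Xray_lin r); [| apply (C1c_ddir r h), Hh | apply (C1c_ddir r k), Hk | exact Hn].
    rewrite (Xray_ddir_self r h hx hy x (ellipse A B th) Hh Hn). reflexivity.
  - replace (- (2 * PI * c) * h x) with (plus (scal (2 * PI - 0) (c * - h x)) (scal e 0)).
    + apply (is_RInt_plus (V := R_NormedModule)).
      * apply (is_RInt_const (V := R_NormedModule)).
      * apply (is_RInt_scal (V := R_NormedModule)), (is_RInt_Xray_tangent r A B k); assumption.
    + unfold plus, scal; simpl; unfold mult; simpl. ring.
Qed.

(** * Reconstruction *)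

(** The scaled form of [Xray_ddir_self], for data that are only known pointwise to be
    directional derivatives. *)
Lemma Xray_scal_ddir_self (r c : R) (h hx hy F : vec -> R) (x a : vec) :
  C1c r h hx hy -> a <> (0, 0) -> (forall p, F p = c * ddir a hx hy p) ->
  Xray a F x = - c * h x.
Proof.
  intros Hh Ha HF.
  pose proof (C1c_ddir r h hx hy a Hh) as HD.
  replace F with (fun p => c * ddir a hx hy p + 0 * ddir a hx hy p).
  - rewrite (Xray_lin r c 0 _ _ x a HD HD Ha), (Xray_ddir_self r h hx hy x a Hh Ha). ring.
  - apply functional_extensionality. intros p. rewrite HF. ring.
Qed.

Lemma reconstruct_vline (r u1 u2 : R) (f : vec -> sym2) (x : vec) :
  unit_vec (u1, u2) -> u1 <> 0 -> u2 <> 0 -> Cc2_sym2 r f ->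
  reconstruct u1 u2 (Lvline (u1, u2) (- u1, u2) f) (Tvline (u1, u2) (- u1, u2) f)
    (Mvline (u1, u2) (- u1, u2) f) x = f x.
Proof.
  intros Hu H1 H2 Hf.
  destruct (vline_data r u1 u2 f Hu H1 Hf)
    as (ex & ey & dx & dy & kx & ky & He & Hd & Hk & ES & EP & EQ).
  unfold unit_vec in Hu; simpl fst in Hu; simpl snd in Hu.
  assert (HA : 2 * u1 ^ 2 <> 0).
  { pose proof (pow2_gt_0 u1 H1). lra. }
  assert (HP : Cc r (fun p => - (2 * u2) * ((u1 ^ 2 - u2 ^ 2) * dy p - 2 * u1 ^ 2 * kx p))).
  { apply (Cc_ext r (fun p => - (2 * u2) * (u1 ^ 2 - u2 ^ 2) * dy p
                              + 4 * u2 * u1 ^ 2 * kx p)).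
    - apply Cc_lin; [apply Hd | apply Hk].
    - intros p. ring. }
  assert (HQ : Cc r (fun p => - u2 * (2 * u1 ^ 2 * dx p + (u1 ^ 2 - u2 ^ 2) * ky p))).
  { apply (Cc_ext r (fun p => - u2 * (2 * u1 ^ 2) * dx p + - u2 * (u1 ^ 2 - u2 ^ 2) * ky p)).
    - apply Cc_lin; [apply Hd | apply Hk].
    - intros p. ring. }
  assert (Htr : rec_trace u1 u2 (Lvline (u1, u2) (- u1, u2) f) (Tvline (u1, u2) (- u1, u2) f) x
                = c11 (f x) + c22 (f x)).
  { unfold rec_trace. rewrite ES.
    rewrite (Xray_scal_ddir_self r (- (2 * u2)) _ _ _ _ x (0, 1) He).
    - field. exact H2.
    - intros E. injection E. lra.
    - intros p. unfold ddir; simpl. ring. }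
  assert (Hdi : rec_diff u1 u2 (Lvline (u1, u2) (- u1, u2) f) (Tvline (u1, u2) (- u1, u2) f)
                  (Mvline (u1, u2) (- u1, u2) f) x = c11 (f x) - c22 (f x)).
  { unfold rec_diff. rewrite EP, EQ.
    destruct (Req_EM_T (u1 ^ 2 - u2 ^ 2) 0) as [Hs | Hs].
    - (* Here [2 u1^2 = u1^2 + u2^2 = 1]. *)
      rewrite (Xray_scal_ddir_self r (- u2) _ _ _ _ x (1, 0) Hd).
      + field. exact H2.
      + intros E. injection E. lra.
      + intros p. rewrite Hs. replace (2 * u1 ^ 2) with 1 by lra. unfold ddir; simpl. ring.
    - assert (HB : - (u1 ^ 2 - u2 ^ 2) <> 0) by lra.
      rewrite (RInt_ext _ (fun th => Xray (ellipse (2 * u1 ^ 2) (- (u1 ^ 2 - u2 ^ 2)) th)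
        (fun p => - (2 * u2) * ddir (ellipse (2 * u1 ^ 2) (- (u1 ^ 2 - u2 ^ 2)) th) dx dy p
          + 2 * u2 * ddir (ellipse' (2 * u1 ^ 2) (- (u1 ^ 2 - u2 ^ 2)) th) kx ky p) x)).
      + rewrite (RInt_ellipse_reconstruct r _ _ _ _ _ _ _ _ _ _ x Hd Hk HA HB).
        field. split; [exact H2 | exact PI_neq0].
      + intros th _. unfold Rminus at 1. rewrite Ropp_mult_distr_l.
        change (2 * u1 ^ 2 * cos th, - (u1 ^ 2 - u2 ^ 2) * sin th)
          with (ellipse (2 * u1 ^ 2) (- (u1 ^ 2 - u2 ^ 2)) th).
        rewrite <- (Xray_lin r _ _ _ _ _ _ HQ HP) by (apply ellipse_neq0; assumption).
        f_equal. apply functional_extensionality. intros p.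
        unfold ddir, ellipse, ellipse'; simpl fst; simpl snd. ring. }
  assert (H12 : rec_12 u1 u2 (Lvline (u1, u2) (- u1, u2) f) (Tvline (u1, u2) (- u1, u2) f)
                  (Mvline (u1, u2) (- u1, u2) f) x = c12 (f x)).
  { unfold rec_12. rewrite EP, EQ.
    destruct (Req_EM_T (u1 ^ 2 - u2 ^ 2) 0) as [Hs | Hs].
    - rewrite (Xray_scal_ddir_self r (2 * u2) _ _ _ _ x (1, 0) Hk).
      + field. exact H2.
      + intros E. injection E. lra.
      + intros p. rewrite Hs. replace (2 * u1 ^ 2) with 1 by lra. unfold ddir; simpl. ring.
    - assert (HB : - (u1 ^ 2 - u2 ^ 2) <> 0) by lra.
      rewrite (RInt_ext _ (fun th => Xray (ellipse (2 * u1 ^ 2) (- (u1 ^ 2 - u2 ^ 2)) th)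
        (fun p => 2 * u2 * ddir (ellipse (2 * u1 ^ 2) (- (u1 ^ 2 - u2 ^ 2)) th) kx ky p
          + 2 * u2 * ddir (ellipse' (2 * u1 ^ 2) (- (u1 ^ 2 - u2 ^ 2)) th) dx dy p) x)).
      + rewrite (RInt_ellipse_reconstruct r _ _ _ _ _ _ _ _ _ _ x Hk Hd HA HB).
        field. split; [exact H2 | exact PI_neq0].
      + intros th _.
        change (2 * u1 ^ 2 * cos th, - (u1 ^ 2 - u2 ^ 2) * sin th)
          with (ellipse (2 * u1 ^ 2) (- (u1 ^ 2 - u2 ^ 2)) th).
        rewrite <- (Xray_lin r _ _ _ _ _ _ HP HQ) by (apply ellipse_neq0; assumption).
        f_equal. apply functional_extensionality. intros p.
        unfold ddir, ellipse, ellipse'; simpl fst; simpl snd. ring. }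
  unfold reconstruct. rewrite Htr, Hdi, H12.
  destruct (f x) as [a b c]; simpl. f_equal; field.
Qed.

Theorem theorem6 (r1 u1 u2 : R) (hr1 : 0 < r1)
  (hu : unit_vec (u1, u2)) (huv : lin_indep (u1, u2) (- u1, u2)) :
  (forall f : vec -> sym2, Cc2_sym2 r1 f ->
     forall x : vec,
       f x = reconstruct u1 u2
               (Lvline (u1, u2) (- u1, u2) f)
               (Tvline (u1, u2) (- u1, u2) f)
               (Mvline (u1, u2) (- u1, u2) f) x) /\
  (forall f g : vec -> sym2, Cc2_sym2 r1 f -> Cc2_sym2 r1 g ->
     (forall x : vec, Lvline (u1, u2) (- u1, u2) f x = Lvline (u1, u2) (- u1, u2) g x) ->
     (forall x : vec, Tvline (u1, u2) (- u1, u2) f x = Tvline (u1, u2) (- u1, u2) g x) ->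
     (forall x : vec, Mvline (u1, u2) (- u1, u2) f x = Mvline (u1, u2) (- u1, u2) g x) ->
     forall x : vec, f x = g x).
Proof.
  unfold lin_indep in huv; simpl fst in huv; simpl snd in huv.
  (* [u1 = 0] would give [u = v], and [u2 = 0] would give [u = - v]. *)
  assert (H1 : u1 <> 0).
  { intros E. destruct (huv 1 (-1)); [rewrite E; ring | ring | lra]. }
  assert (H2 : u2 <> 0).
  { intros E. destruct (huv 1 1); [ring | rewrite E; ring | lra]. }
  split.
  - intros f Hf x. symmetry. now apply (reconstruct_vline r1).
  - intros f g Hf Hg HL HT HM x.
    rewrite <- (reconstruct_vline r1 u1 u2 f x), <- (reconstruct_vline r1 u1 u2 g x) by assumption.
    apply functional_extensionality in HL, HT, HM.
    now rewrite HL, HT, HM.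
Qed.
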